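(* Let $R$ be a ring, let $M$ be a left $R$-module and let $T$ be a maximal submodule of $M$. The following conditions are equivalent: (1) $|G(M)|$ is infinite and $\deg(T)<\infty$; (2) there are submodules $S$ and $S'$ of $M$ such that all of the following hold: (i) $S$ is simple and $M=S\oplus T$; (ii) $S'$ is the unique essential simple submodule of $T$, and $S'\simeq S$; (iii) $\mathrm{End}(S)$ is an infinite division ring; (iv) $G(M/S')$ is finite.
   Context: Rings are associative with unity and modules are unitary left modules. A nontrivial submodule of $M$ is a submodule different from $0$ and $M$. The intersection graph $G(M)$ is the simple graph whose vertices are the nontrivial submodules of $M$, two distinct vertices being adjacent iff their intersection is nonzero; $|G(M)|$ is the cardinality of its vertex set. For a submodule $N$ of $M$, $\deg(N)$ is the cardinality of the set of all nontrivial submodules $K\neq N$ of $M$ with $N\cap K\neq 0$ (the degree of $N$ in $G(M)$). A submodule is essential if it intersects every nonzero submodule nontrivially. $\mathrm{End}(S)$ is the ring of $R$-endomorphisms of $S$. *)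

(* Defs.v *)
From HB Require Import structures.
From mathcomp Require Import all_boot all_order all_algebra.
From mathcomp Require Import boolp classical_sets cardinality.
Set Implicit Arguments.
Unset Strict Implicit.
Unset Printing Implicit Defensive.
Import GRing.Theory Quotient.
Local Open Scope ring_scope.

(* Submodules are the library's bundles [submodClosed M]. They are carried by
   boolean predicates, which loses nothing classically: any [A : set M] is the
   predicate [mem A]. Bundles with the same elements are equal, so sets of
   submodules are not inflated by the proofs in the bundles. *)
Section Submodules.
Variables (R : pzRingType) (M : lmodType R).
Implicit Types N K L : submodClosed M.

Lemma submod_inj N K : N =i K -> N = K.
Proof.
move=> eqNK; have: (N : {pred M}) = K by apply: funext => x; apply: eqNK.
case: N K {eqNK} => N [[aN] [sN]] [K [[aK] [sK]]] /= eqNK.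
rewrite -{K}eqNK in aK sK *.
by rewrite (Prop_irrelevance aN aK) (Prop_irrelevance sN sK).
Qed.

Definition is_zero (A : {pred M}) : Prop := A =i pred1 0.

Definition nontrivial N : Prop := ~ is_zero N /\ ~ (N =i predT).

Definition maximal_submod N : Prop :=
  ~ (N =i predT) /\
  forall K, {subset N <= K} -> K =i N \/ K =i predT.

Definition direct_sum N K : Prop :=
  is_zero [predI N & K] /\
  forall x : M, exists y z : M, [/\ y \in N, z \in K & x = y + z].

(* K is an essential submodule of the submodule N. *)
Definition essential_in N K : Prop :=
  {subset K <= N} /\
  forall L, {subset L <= N} -> ~ is_zero L -> ~ is_zero [predI K & L].

Definition vertices : set (submodClosed M) := [set N | nontrivial N].

Definition adjacent N K : Prop := K <> N /\ ~ is_zero [predI N & K].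

(* deg N is the cardinality of [neighbours N], also when N is 0 or M and hence
   not a vertex. *)
Definition neighbours N : set (submodClosed M) :=
  [set K | nontrivial K /\ adjacent N K].

End Submodules.

Arguments vertices {R} M.

Definition simple_module (R : pzRingType) (M : lmodType R) : Prop :=
  (exists x : M, x != 0) /\
  forall N : submodClosed M, is_zero N \/ N =i predT.

Section SubmoduleAsModule.
Variables (R : pzRingType) (M : lmodType R) (N : submodClosed M).

Definition submod : Type := {x : M | x \in N}.

HB.instance Definition _ := SubChoice.on submod.

Fact submod_subproof : GRing.submod_closed N.
Proof. exact: GRing.submodClosedP. Qed.

HB.instance Definition _ :=
  GRing.SubChoice_isSubLmodule.Build R M _ submod submod_subproof.

End SubmoduleAsModule.

Definition isomorphic (R : pzRingType) (M N : lmodType R) : Prop :=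
  exists f : {linear M -> N}, bijective f.

Definition essential_simple_in (R : pzRingType) (M : lmodType R)
    (T K : submodClosed M) : Prop :=
  essential_in T K /\ simple_module (submod K).

Section QuotientModule.
Variables (R : pzRingType) (M : lmodType R) (N : submodClosed M).

Fact submod_opp_closed : oppr_closed N.
Proof. by move=> x Nx; rewrite -scaleN1r rpredZ. Qed.

Definition submod_zmod : zmodClosed M :=
  HB.pack (N : {pred M}) (GRing.SubmodClosed.class N)
    (GRing.isOppClosed.Build M N submod_opp_closed).

Definition quotmod : Type := {quot submod_zmod}.

HB.instance Definition _ := GRing.Zmodule.on quotmod.

Local Open Scope quotient_scope.

Definition scaleq (a : R) (x : quotmod) : quotmod :=
  \pi_({quot submod_zmod}) (a *: repr x).

Fact pi_scale a (x : M) :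
  \pi_({quot submod_zmod}) (a *: x) = scaleq a (\pi_({quot submod_zmod}) x).
Proof.
apply/eqP; rewrite -Quotient.idealrBE -scalerBr; apply: (@rpredZ _ _ N).
have : x - repr (\pi_({quot submod_zmod}) x) \in submod_zmod.
  by rewrite Quotient.idealrBE reprK.
by [].
Qed.

Fact quotmodP (x : quotmod) : exists y : M, x = \pi_({quot submod_zmod}) y.
Proof. by exists (repr x); rewrite reprK. Qed.

Fact scaleqA a b x : scaleq a (scaleq b x) = scaleq (a * b) x.
Proof. by have [y ->] := quotmodP x; rewrite -!pi_scale scalerA. Qed.

Fact scale1q : left_id 1 scaleq.
Proof. by move=> x; have [y ->] := quotmodP x; rewrite -pi_scale scale1r. Qed.

Fact scaleqDr : right_distributive scaleq +%R.
Proof.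
move=> a x y; have [u ->] := quotmodP x; have [v ->] := quotmodP y.
by rewrite -raddfD -!pi_scale -raddfD scalerDr.
Qed.

Fact scaleqDl x : {morph scaleq^~ x : a b / a + b}.
Proof.
move=> a b; have [y ->] := quotmodP x.
by rewrite -!pi_scale -raddfD scalerDl.
Qed.

HB.instance Definition _ :=
  GRing.Zmodule_isLmodule.Build R quotmod scaleqA scale1q scaleqDr scaleqDl.

End QuotientModule.

Section EndomorphismRing.
Variables (R : pzRingType) (M : lmodType R).

(* Addition is pointwise, the product is composition. *)
Definition endo : Type := {linear M -> M}.

HB.instance Definition _ := gen_eqMixin endo.
HB.instance Definition _ := gen_choiceMixin endo.

Implicit Types f g h : endo.

Fact endoP f g : (f : M -> M) =1 g -> f = g.
Proof.
case: f g => f cf [g cg] /= /funext eqfg; case: _ / eqfg in cg *.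
case: cf cg => [[a] [s]] [[b] [t]].
by rewrite (Prop_irrelevance a b) (Prop_irrelevance s t).
Qed.

Definition endo_zero : endo := \0.
Definition endo_opp f : endo := \- f.
Definition endo_add f g : endo := f \+ g.
Definition endo_one : endo := idfun.
Definition endo_mul f g : endo := f \o g.

Fact endo_addA : associative endo_add.
Proof. by move=> f g h; apply: endoP => x /=; rewrite addrA. Qed.
Fact endo_addC : commutative endo_add.
Proof. by move=> f g; apply: endoP => x /=; rewrite addrC. Qed.
Fact endo_add0 : left_id endo_zero endo_add.
Proof. by move=> f; apply: endoP => x /=; rewrite add0r. Qed.
Fact endo_addN : left_inverse endo_zero endo_opp endo_add.
Proof. by move=> f; apply: endoP => x /=; rewrite addNr. Qed.
Fact endo_mulA : associative endo_mul.
Proof. by move=> f g h; apply: endoP. Qed.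
Fact endo_mul1 : left_id endo_one endo_mul.
Proof. by move=> f; apply: endoP. Qed.
Fact endo_mulr1 : right_id endo_one endo_mul.
Proof. by move=> f; apply: endoP. Qed.
Fact endo_mulDl : left_distributive endo_mul endo_add.
Proof. by move=> f g h; apply: endoP. Qed.
Fact endo_mulDr : right_distributive endo_mul endo_add.
Proof. by move=> f g h; apply: endoP => x /=; rewrite raddfD. Qed.

HB.instance Definition _ :=
  GRing.isZmodule.Build endo endo_addA endo_addC endo_add0 endo_addN.
HB.instance Definition _ := GRing.Zmodule_isPzRing.Build endo
  endo_mulA endo_mul1 endo_mulr1 endo_mulDl endo_mulDr.

End EndomorphismRing.

Definition division_ring (D : pzRingType) : Prop :=
  1 != 0 :> D /\
  forall x : D, x != 0 -> exists y : D, y * x = 1 /\ x * y = 1.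

(* Main.v *)
Require Import Defs.
From HB Require Import structures.
From mathcomp Require Import all_boot all_order all_algebra.
From mathcomp Require Import boolp classical_sets cardinality.
Import GRing.Theory.
Local Open Scope classical_set_scope.
Local Open Scope ring_scope.
Set Implicit Arguments.
Unset Strict Implicit.
Unset Printing Implicit Defensive.

(* A nonzero submodule of M that is neither T nor a neighbour of T meets T
   trivially, hence is a complement of T, and it is simple because T is
   maximal. So (1) forces infinitely many complements of T. Fix one of them,
   S; any other complement K is the graph of a linear map from S to T, whose
   image is the intersection of K + S and T, the shadow of K. As T has
   finitely many submodules, infinitely many complements share a shadow S',
   whence S' is isomorphic to S and End(S) is infinite. A nonzero submodule L
   of T meeting S' trivially would make the submodules K + L, for K with
   shadow S', infinitely many distinct neighbours of T; so S' is essential in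
   T. Submodules of M containing S' are neighbours of T, up to T and M
   themselves, so M/S' has finitely many submodules. Conversely, the graphs of
   the maps S -> S' are infinitely many vertices, and every neighbour of T
   contains S'. *)

(** * Finite sets: injections and fibres *)

Section FiniteSets.
Variables (T U : Type) (f : T -> U).

Lemma finite_set_injto (A : set T) (B : set U) :
  {in A &, injective f} -> (forall x, A x -> B (f x)) -> finite_set B ->
  finite_set A.
Proof.
move=> f_inj fAB finB; rewrite -(eq_finite_set (inj_card_eq f_inj)).
by apply: sub_finite_set finB => _ [x Ax <-]; apply: fAB.
Qed.

(** Pigeonhole: otherwise [A] would be covered by finitely many finite fibres. *)
Lemma infinite_fibre (A : set T) (B : set U) :
  (forall x, A x -> B (f x)) -> finite_set B -> infinite_set A ->
  exists2 y, B y & infinite_set [set x | A x /\ f x = y].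
Proof.
move=> fAB finB infA; apply: contrapT => no_fibre; apply: infA.
apply: (@sub_finite_set _ _ (\bigcup_(y in B) [set x | A x /\ f x = y])).
  by move=> x Ax; exists (f x); [apply: fAB|].
apply: bigcup_finite => // y By; apply: contrapT => inf_y.
by apply: no_fibre; exists y.
Qed.

End FiniteSets.

(** * Submodules cut out by propositional predicates *)

Section SubmoduleConstruction.
Variables (R : pzRingType) (M : lmodType R) (A : set M).
Hypothesis A_submod : A 0 /\ forall a x y, A x -> A y -> A (a *: x + y).

Definition submod_of_pred : {pred M} := fun x => `[< A x >].

Lemma submod_of_closed : GRing.subsemimod_closed submod_of_pred.
Proof.
case: A_submod => A0 AD; apply: GRing.submod_closed_semi.
split; first exact/asboolP.
by move=> a x y /asboolP Ax /asboolP Ay; apply/asboolP/AD.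
Qed.

Definition submod_of : submodClosed M :=
  HB.pack submod_of_pred
    (GRing.isSubmodClosed.Build R M submod_of_pred submod_of_closed).

Lemma submod_ofP x : reflect (A x) (x \in submod_of).
Proof. exact: asboolP. Qed.

End SubmoduleConstruction.

(** * Intersections and sums of submodules *)

Section Lattice.
Variables (R : pzRingType) (M : lmodType R).
Implicit Types N K L S T : submodClosed M.

Lemma submodB N x y : x \in N -> y \in N -> x - y \in N.
Proof. by move=> Nx Ny; rewrite -scaleN1r rpredD ?rpredZ. Qed.

Lemma capm_subproof N K : let A x := x \in N /\ x \in K in
  A 0 /\ forall a x y, A x -> A y -> A (a *: x + y).
Proof.
split=> [|a x y [Nx Kx] [Ny Ky]]; first by rewrite !rpred0.
by split; rewrite rpredD ?rpredZ.
Qed.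

Definition capm N K := submod_of (capm_subproof N K).

Lemma capmP N K x : reflect (x \in N /\ x \in K) (x \in capm N K).
Proof. exact: submod_ofP. Qed.

Lemma addm_subproof N K :
  let A x := exists y z, [/\ y \in N, z \in K & x = y + z] in
  A 0 /\ forall a x y, A x -> A y -> A (a *: x + y).
Proof.
split=> [|a _ _ [y [z [Ny Kz ->]]] [y' [z' [Ny' Kz' ->]]]].
  by exists 0, 0; rewrite !rpred0 addr0.
exists (a *: y + y'), (a *: z + z').
by rewrite !rpredD ?rpredZ // scalerDr addrACA.
Qed.

Definition addm N K := submod_of (addm_subproof N K).

Lemma addmP N K x :
  reflect (exists y z, [/\ y \in N, z \in K & x = y + z]) (x \in addm N K).
Proof. exact: submod_ofP. Qed.

Lemma sub_addml N K : {subset N <= addm N K}.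
Proof. by move=> x Nx; apply/addmP; exists x, 0; rewrite rpred0 addr0. Qed.

Lemma sub_addmr N K : {subset K <= addm N K}.
Proof. by move=> x Kx; apply/addmP; exists 0, x; rewrite rpred0 add0r. Qed.

Lemma is_zeroP N : is_zero N <-> forall x, x \in N -> x = 0.
Proof.
split=> [N0 x|N0 x]; first by rewrite N0 inE => /eqP.
by rewrite inE; apply/idP/eqP => [/N0|->]; rewrite ?rpred0.
Qed.

Lemma not_zeroP N : ~ is_zero N <-> exists2 x, x \in N & x != 0.
Proof.
split=> [nzN|[x Nx /eqP x0] /is_zeroP/(_ x Nx)//].
apply: contrapT => noN; apply: nzN; apply/is_zeroP => x Nx.
by apply: contrapT => /eqP x0; apply: noN; exists x.
Qed.

Lemma is_zeroI N K : is_zero [predI N & K] <-> is_zero (capm N K).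
Proof.
have eqNK : [predI N & K] =i capm N K.
  by move=> x; rewrite inE; apply/andP/capmP.
by split=> NK0 x; rewrite -NK0 eqNK.
Qed.

Lemma disjointP N K :
  is_zero [predI N & K] <-> forall x, x \in N -> x \in K -> x = 0.
Proof.
rewrite is_zeroI is_zeroP; split=> NK0 x; last by case/capmP; apply: NK0.
by move=> Nx Kx; apply: NK0; apply/capmP.
Qed.

End Lattice.

(** * Simplicity, finiteness and maximality in the lattice of submodules *)

Section SimpleSubmodules.
Variables (R : pzRingType) (M : lmodType R).
Implicit Types N K L S T : submodClosed M.

Definition submod_elt N x (Nx : x \in N) : submod N :=
  exist (fun y => y \in N) x Nx.

(** Pulling back and pushing forward along [val] matches submodules of [submod N] with submodules of
    [M] below [N], so later arguments can stay inside [M]. *)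
Lemma simple_submodP N :
  simple_module (submod N) <->
  ~ is_zero N /\ forall L, {subset L <= N} -> is_zero L \/ L =i N.
Proof.
split=> [[[x x0] simN]|[nzN simN]]; split.
- apply/not_zeroP; exists (val x); first exact: (valP x).
  by apply: contra x0 => /eqP x0; apply/eqP/val_inj.
- move=> L LN; pose A (u : submod N) := val u \in L.
  have A_submod : A 0 /\ forall a x y, A x -> A y -> A (a *: x + y).
    by split=> [|a u v Lu Lv]; rewrite /A ?rpred0 // linearP rpredD ?rpredZ.
  case: (simN (submod_of A_submod)) => [/is_zeroP L0|LT]; [left|right].
    apply/is_zeroP => u Lu.
    have u0 : submod_elt (LN u Lu) = 0 by apply/L0/submod_ofP.
    exact: (congr1 val u0).
  move=> u; apply/idP/idP => [/LN//|Nu].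
  have /submod_ofP // : submod_elt Nu \in submod_of A_submod.
  by rewrite LT.
- have [x Nx x0] := (not_zeroP N).1 nzN.
  by exists (submod_elt Nx); apply: contra x0 => /eqP /(congr1 val) /= ->.
- move=> L; pose A x := exists2 u : submod N, u \in L & val u = x.
  have A_submod : A 0 /\ forall a x y, A x -> A y -> A (a *: x + y).
    split=> [|a _ _ [u Lu <-] [v Lv <-]]; first by exists 0; rewrite ?rpred0.
    by exists (a *: u + v); rewrite ?rpredD ?rpredZ ?linearP.
  have AN : {subset submod_of A_submod <= N}.
    by move=> _ /submod_ofP[u _ <-]; apply: valP.
  case: (simN _ AN).
  + move=> /is_zeroP L0; left; apply/is_zeroP => u Lu; apply/val_inj/L0.
    by apply/submod_ofP; exists u.
  + move=> LN; right => u; rewrite [RHS]inE.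
    have : val u \in submod_of A_submod by rewrite LN; apply: valP.
    by case/submod_ofP => v Lv /val_inj <-.
Qed.

Lemma simple_subset S N :
  simple_module (submod S) -> ~ is_zero [predI S & N] -> {subset S <= N}.
Proof.
move=> /simple_submodP[_ simS] nz.
have capS : {subset capm S N <= S} by move=> x /capmP[].
case: (simS _ capS) => [/is_zeroI//|SN].
by move=> x; rewrite -SN => /capmP[].
Qed.

Lemma finite_set_eqi (A : {pred M}) :
  finite_set [set N : submodClosed M | N =i A].
Proof.
have [[N NA]|noA] := pselect (exists N : submodClosed M, N =i A).
  apply: (sub_finite_set _ (finite_set1 N)) => K KA.
  by apply/submod_inj => x; rewrite KA NA.
rewrite (_ : [set N | _] = set0) //.
by apply/seteqP; split=> // N NA; apply: noA; exists N.
Qed.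

(** Only 0 and [M] fail to be vertices, and each is a single bundle by [submod_inj]. *)
Lemma finite_verticesP : finite_set (vertices M) <->
  finite_set [set: submodClosed M].
Proof.
split=> [fin|]; last exact: sub_finite_set.
apply: (@sub_finite_set _ _ (vertices M `|` [set N | N =i pred1 0]
    `|` [set N | N =i predT])).
  move=> N _; have [N0|nzN] := pselect (is_zero N); first by left; right.
  have [NT|nNT] := pselect (N =i predT); first by right.
  by left; left.
by rewrite !finite_setU; do !split=> //; apply: finite_set_eqi.
Qed.

Lemma maximal_addm T K :
  maximal_submod T -> ~ {subset K <= T} -> addm K T =i predT.
Proof.
case=> _ maxT nKT; case: (maxT (addm K T) (@sub_addmr _ _ K T)) => //.
by move=> eqT; case: nKT => x Kx; rewrite -eqT sub_addml.
Qed.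

End SimpleSubmodules.

(** * Linear maps obtained from linear relations *)

Section LinearRelation.
Variables (R : pzRingType) (U V : lmodType R) (G : U -> V -> Prop).

(** Two values of [G] at one point differ by a value at 0, so [G] is single-valued and any choice of
    values is linear. *)
Lemma linear_of_rel :
  (forall u, exists v, G u v) -> (forall v, G 0 v -> v = 0) ->
  (forall a u u' v v', G u v -> G u' v' -> G (a *: u + u') (a *: v + v')) ->
  exists f : {linear U -> V}, forall u, G u (f u).
Proof.
move=> /choice[f Gf] G0 GD.
have f_linear : linear f.
  move=> a u v; apply/subr0_eq/G0.
  have := GD (- 1) _ _ _ _ (GD a _ _ _ _ (Gf u) (Gf v)) (Gf (a *: u + v)).
  by rewrite !scaleN1r addNr [- _ + _]addrC.
pose g : {linear U -> V} :=
  HB.pack f (GRing.isLinear.Build R U V *:%R f f_linear).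
by exists g.
Qed.

End LinearRelation.

(** * Schur's lemma *)

Section Schur.
Variables (R : pzRingType) (U V : lmodType R).

Lemma linear_inverse (f : {linear U -> V}) :
  bijective f -> exists g : {linear V -> U}, cancel f g /\ cancel g f.
Proof.
case=> g fK gK; have g_linear := can2_linear fK gK.
pose h : {linear V -> U} :=
  HB.pack g (GRing.isLinear.Build R V U *:%R g g_linear).
by exists h.
Qed.

Lemma simple_injective (f : {linear U -> V}) :
  simple_module U -> (exists x, f x != 0) -> injective f.
Proof.
move=> [_ simU] [x fx0]; pose A u := f u = 0.
have A_submod : A 0 /\ forall a x y, A x -> A y -> A (a *: x + y).
  split=> [|a u v fu fv]; first exact: linear0.
  by rewrite /A linearP fu fv scaler0 addr0.
case: (simU (submod_of A_submod)) => [/is_zeroP ker0|kerT]; last first.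
  have /submod_ofP xA : x \in submod_of A_submod by rewrite kerT.
  by rewrite xA eqxx in fx0.
move=> u v eq_fuv; apply/subr0_eq/ker0/submod_ofP.
by rewrite /A linearB eq_fuv subrr.
Qed.

Lemma simple_surjective (f : {linear U -> V}) :
  simple_module V -> (exists x, f x != 0) -> forall v, exists u, f u = v.
Proof.
move=> [_ simV] [x fx0]; pose A v := exists u, f u = v.
have A_submod : A 0 /\ forall a x y, A x -> A y -> A (a *: x + y).
  split=> [|a _ _ [u <-] [v <-]]; first by exists 0; apply: linear0.
  by exists (a *: u + v); rewrite linearP.
case: (simV (submod_of A_submod)) => [/is_zeroP im0|imT] v; last first.
  by have /submod_ofP : v \in submod_of A_submod by rewrite imT.
have fx : f x = 0 by apply/im0/submod_ofP; exists x.
by rewrite fx eqxx in fx0.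
Qed.

Lemma inj_surj_bijective (f : U -> V) :
  injective f -> (forall v, exists u, f u = v) -> bijective f.
Proof.
move=> f_inj /choice[g gK]; exists g => // u; exact: f_inj.
Qed.

Lemma simple_image (f : {linear U -> V}) :
  simple_module U -> bijective f -> simple_module V.
Proof.
move=> [[x x0] simU] [g fK gK]; split.
  exists (f x); apply: contra x0 => /eqP fx0.
  by rewrite -(fK x) fx0 -(linear0 f) fK.
move=> N; pose A u := f u \in N.
have A_submod : A 0 /\ forall a x y, A x -> A y -> A (a *: x + y).
  split=> [|a u v Nu Nv]; rewrite /A ?linear0 ?rpred0 //.
  by rewrite linearP rpredD ?rpredZ.
case: (simU (submod_of A_submod)) => [/is_zeroP N0|NT]; [left|right].
  apply/is_zeroP => v Nv; rewrite -(gK v) (N0 (g v)) ?linear0 //.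
  by apply/submod_ofP; rewrite /A gK.
move=> v; have /submod_ofP : g v \in submod_of A_submod by rewrite NT.
by rewrite /A gK.
Qed.

End Schur.

Lemma simple_division_ring (R : pzRingType) (S : lmodType R) :
  simple_module S -> division_ring (endo S).
Proof.
move=> simS; have [[x x0] _] := simS; split.
  apply: contra x0 => /eqP eq10.
  by have /= := congr1 (fun f : endo S => f x) eq10 => ->.
move=> f f0; have fn0 : exists x, f x != 0.
  apply: contrapT => fn0; case/eqP: f0; apply: endoP => u.
  by apply: contrapT => /eqP fu0; apply: fn0; exists u.
have [g [fK gK]] := linear_inverse
  (inj_surj_bijective (simple_injective simS fn0) (simple_surjective simS fn0)).
by exists g; split; apply: endoP.
Qed.

(** * The correspondence theorem for [M/N] *)

Section Quotient.
Import Quotient.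
Local Open Scope quotient_scope.
Variables (R : pzRingType) (M : lmodType R) (N : submodClosed M).

Definition proj (x : M) : quotmod N :=
  \pi_({quot submod_zmod N}) x.

Lemma proj_linear : linear proj.
Proof.
by move=> a x y; rewrite /proj raddfD; congr (_ + _); apply: pi_scale.
Qed.

HB.instance Definition _ :=
  GRing.isLinear.Build R M (quotmod N) *:%R proj proj_linear.

Lemma proj_eq0 x : (proj x == 0) = (x \in N).
Proof.
by rewrite -[0](linear0 proj) /proj -idealrBE subr0.
Qed.

Lemma proj_surj u : exists x, proj x = u.
Proof. by have [x ->] := quotmodP u; exists x. Qed.

Lemma preim_proj_subproof (L : submodClosed (quotmod N)) :
  let A x := proj x \in L in
  A 0 /\ forall a x y, A x -> A y -> A (a *: x + y).
Proof.
split=> [|a u v Lu Lv] /=; rewrite ?linear0 ?rpred0 //.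
by rewrite linearP rpredD ?rpredZ.
Qed.

Definition preim_proj L := submod_of (preim_proj_subproof L).

Lemma mem_preim_proj L x : (x \in preim_proj L) = (proj x \in L).
Proof. by apply/submod_ofP/idP. Qed.

Lemma im_proj_subproof (K : submodClosed M) :
  let A u := exists2 x, x \in K & proj x = u in
  A 0 /\ forall a x y, A x -> A y -> A (a *: x + y).
Proof.
split=> [|a _ _ [x Kx <-] [y Ky <-]].
  by exists 0; rewrite ?rpred0 ?linear0.
by exists (a *: x + y); rewrite ?linearP // rpredD ?rpredZ.
Qed.

Definition im_proj K := submod_of (im_proj_subproof K).

Lemma im_projK (K : submodClosed M) :
  {subset N <= K} -> preim_proj (im_proj K) = K.
Proof.
move=> NK; apply: submod_inj => x; rewrite mem_preim_proj.
apply/submod_ofP/idP => [[y Ky /eqP]|Kx]; last by exists x.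
rewrite -subr_eq0 -linearB proj_eq0 => /NK Kyx.
by rewrite -[x](subKr y) submodB.
Qed.

Lemma preim_projK L : im_proj (preim_proj L) = L.
Proof.
apply: submod_inj => u; have [x <-] := proj_surj u.
apply/submod_ofP/idP => [[y + <-]|Lu]; first by rewrite mem_preim_proj.
by exists x; rewrite ?mem_preim_proj.
Qed.

Lemma finite_vertices_quotmodP : finite_set (vertices (quotmod N)) <->
  finite_set [set K : submodClosed M | {subset N <= K}].
Proof.
rewrite finite_verticesP; split=> [fin|fin].
  apply: (finite_set_injto (f := im_proj) _ _ fin) => // K L.
  rewrite !inE => NK NL eqKL.
  by rewrite -[K]im_projK // eqKL im_projK.
apply: (finite_set_injto (f := preim_proj) _ _ fin).
  by move=> K L _ _ eqKL; rewrite -[K]preim_projK eqKL preim_projK.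
move=> L _ x Nx; rewrite mem_preim_proj.
by have /eqP -> : proj x == 0; rewrite ?rpred0 // proj_eq0.
Qed.

End Quotient.

(** * Complements of a maximal submodule and their shadows *)

Section Complements.
Variables (R : pzRingType) (M : lmodType R) (T : submodClosed M).
Hypothesis maxT : maximal_submod T.
Implicit Types S E K L : submodClosed M.

(** Being nonzero stands in for K + T = M, which then follows from the maximality of [T]. *)
Definition complement K := ~ is_zero K /\ is_zero [predI K & T].

Lemma complement_addm K : complement K -> addm K T =i predT.
Proof.
move=> [/not_zeroP[x Kx /eqP x0] /disjointP KT0].
by apply: maximal_addm => // KT; apply: x0; apply: KT0 => //; apply: KT.
Qed.

(** A nonzero [L] inside [K] is again a complement. Writing x in [K] as l + t puts t in both [K] and
    [T], so x = l. *)
Lemma complement_simple K : complement K -> simple_module (submod K).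
Proof.
move=> [nzK /disjointP KT0]; apply/simple_submodP; split=> // L LK.
have [L0|nzL] := pselect (is_zero L); [by left|right=> x].
apply/idP/idP => [/LK//|Kx].
have compL : complement L.
  by split=> //; apply/disjointP => y /LK; apply: KT0.
have /addmP[l [t [Ll Tt eqx]]] : x \in addm L T by rewrite complement_addm.
suff t0 : t = 0 by rewrite eqx t0 addr0.
by apply: KT0 => //; rewrite -[t](addKr l) -eqx addrC submodB // LK.
Qed.

(** The larger complement is simple. Thanks to this, equality of complements is always proved below
    by a single inclusion. *)
Lemma complement_eq K L :
  complement K -> complement L -> {subset K <= L} -> K = L.
Proof.
move=> [nzK _] /complement_simple/simple_submodP[_ simL] KL.
by apply: submod_inj; case: (simL K KL).
Qed.

(** When [S] is a complement of [T], this is the image of [K] under the projection onto [T] along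
    [S]. *)
Definition shadow S K := capm (addm K S) T.

Lemma complement_map S K : complement S -> complement K ->
  exists f : {linear submod S -> submod (shadow S K)},
    forall s, val s + val (f s) \in K.
Proof.
move=> compS compK; have [_ /disjointP KT0] := compK.
apply: (@linear_of_rel _ _ _
  (fun (s : submod S) (t : submod (shadow S K)) => val s + val t \in K)).
- move=> s; have /addmP[k [t [Kk Tt eqs]]] : val s \in addm K T.
    by rewrite complement_addm.
  have eqt : val s - k = t by rewrite eqs addrC addKr.
  (* Since s = k + t with k in [K], the value at s has to be -t. *)
  have shadow_t : - t \in shadow S K.
    apply/capmP; split; last by rewrite -sub0r submodB ?rpred0.
    apply/addmP; exists k, (- val s); split=> //.
      by rewrite -sub0r submodB ?rpred0 //; apply: valP.
    by rewrite -eqt opprB.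
  by exists (submod_elt shadow_t); rewrite /= -eqt opprB addrC subrK.
- move=> t; rewrite linear0 add0r => Kt; apply: val_inj; apply: KT0 => //.
  by have /capmP[] := valP t.
- move=> a s s' t t' Kst Kst'.
  by rewrite !linearP /= addrACA -scalerDr rpredD ?rpredZ.
Qed.

(** If x in [K] has [S]-component s, then x and s + f s are both in [K] and differ by an element of
    [T], hence agree. *)
Lemma complement_graph S K (f : submod S -> M) :
    complement S -> complement K ->
    (forall s, f s \in T) -> (forall s, val s + f s \in K) ->
  forall x, x \in K -> exists s, x = val s + f s.
Proof.
move=> compS [_ /disjointP KT0] Tf Kf x Kx.
have /addmP[s [t [Ss Tt eqx]]] : x \in addm S T by rewrite complement_addm.
exists (submod_elt Ss); apply/subr0_eq/KT0; first by rewrite submodB.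
by rewrite eqx /= opprD addrACA subrr add0r submodB.
Qed.

Lemma shadow_neq0 S K :
  complement S -> complement K -> K <> S -> ~ is_zero (shadow S K).
Proof.
move=> compS compK neqKS /is_zeroP shadow0; apply: neqKS; apply/esym.
have [f Kf] := complement_map compS compK.
apply: complement_eq => // s Ss; have := Kf (submod_elt Ss).
by rewrite (shadow0 (val (f _))) ?addr0 //; apply: valP.
Qed.

(** If [f] were zero, [K] would contain [S] and so equal it; as [S] is simple, a nonzero [f] is
    injective. Surjectivity comes from the definition of the shadow. *)
Lemma complement_map_bij S K (f : {linear submod S -> submod (shadow S K)}) :
    complement S -> complement K -> K <> S ->
  (forall s, val s + val (f s) \in K) -> bijective f.
Proof.
move=> compS compK neqKS Kf; have [_ /disjointP KT0] := compK.
have simS := complement_simple compS.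
apply: inj_surj_bijective.
  apply: simple_injective => //; apply: contrapT => f0; apply: neqKS.
  apply/esym/complement_eq => // s Ss; have := Kf (submod_elt Ss).
  suff -> : f (submod_elt Ss) = 0 by rewrite linear0 addr0.
  by apply: contrapT => /eqP fs0; apply: f0; exists (submod_elt Ss).
move=> t; have /capmP[/addmP[k [s [Kk Ss eqt]]] Tt] := valP t.
(* With t = k + s, the elements k and -s + f (-s) of [K] differ by t - f (-s), which lies in [T]. *)
exists (- submod_elt Ss); apply/val_inj/esym/subr0_eq/KT0.
  have := submodB Kk (Kf (- submod_elt Ss)).
  by rewrite eqt !linearN /= opprD opprK addrA.
by rewrite submodB //; have /capmP[] := valP (f (- submod_elt Ss)).
Qed.

Lemma infinite_complements :
  infinite_set (vertices M) -> finite_set (neighbours T) ->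
  infinite_set [set K | complement K].
Proof.
move=> infM finT finC; apply: infM.
apply: (@sub_finite_set _ _ (neighbours T `|` [set T] `|`
  [set K | complement K])).
  move=> K [nzK nKM]; have [->|neqKT] := pselect (K = T); first by left; right.
  have [KT0|nz] := pselect (is_zero [predI T & K]); last by left; left.
  right; split=> //; apply/disjointP => x Kx Tx.
  exact: (disjointP _ _).1 KT0 x Tx Kx.
by rewrite !finite_setU; do !split.
Qed.

Lemma finite_nonzero_submods : finite_set (neighbours T) ->
  finite_set [set L : submodClosed M | ~ is_zero L /\ {subset L <= T}].
Proof.
move=> finT; apply: (@sub_finite_set _ _ (neighbours T `|` [set T])).
  move=> L [nzL LT]; have [->|neqLT] := pselect (L = T); [by right|left].
  split; first split=> //.
    by move=> LM; case: maxT => + _; apply => x; apply: LT; rewrite LM.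
  split=> // /disjointP TL0; apply: nzL; apply/is_zeroP => x Lx.
  by apply: TL0 => //; apply: LT.
by rewrite finite_setU; split.
Qed.

(** Each such submodule meets [T] in at least [E], so it is [T], [M] or a neighbour of [T]. *)
Lemma finite_oversubmods E :
  ~ is_zero E -> {subset E <= T} -> finite_set (neighbours T) ->
  finite_set [set K : submodClosed M | {subset E <= K}].
Proof.
move=> /not_zeroP[x Ex /eqP x0] ET finT.
apply: (@sub_finite_set _ _ (neighbours T `|` [set T] `|`
  [set K | K =i predT])).
  move=> K EK; have [->|neqKT] := pselect (K = T); first by left; right.
  have [KM|nKM] := pselect (K =i predT); [by right|left; left].
  split; split=> //; first by move/is_zeroP/(_ x (EK x Ex)).
  by move/disjointP/(_ x (ET x Ex) (EK x Ex)).
rewrite !finite_setU; do !split=> //.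
exact: finite_set_eqi.
Qed.

(** If a nonzero [L] inside [T] met [E] trivially, sending K to K + L would embed the infinite fibre
    over [E] into the finite set of neighbours of [T]. *)
Lemma essential_of_infinite_fibre S E :
    complement S -> ~ is_zero E -> {subset E <= T} ->
    infinite_set [set K | complement K /\ shadow S K = E] ->
  finite_set (neighbours T) -> essential_in T E.
Proof.
move=> compS nzE ET infF finT; split=> // L LT nzL.
move=> /disjointP EL0; apply: infF; have [_ /disjointP ST0] := compS.
apply: (@finite_set_injto _ _ (fun K => addm K L) _ (neighbours T)) => //;
  last first.
  move=> K [[nzK /disjointP KT0] _].
  (* Modular law: K + L meets [T] only in [L]. *)
  have addLT x : x \in addm K L -> x \in T -> x \in L.
    move=> /addmP[k [l [Kk Ll ->]]] Tx.
    rewrite (KT0 k) ?add0r // -[k](addrK l) submodB //; exact: LT.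
  have addKL : {subset K <= addm K L} by apply: sub_addml.
  split; split.
  - by move/is_zeroP => KL0; apply: nzK; apply/is_zeroP => x /addKL/KL0.
  (* K + L = M would put [T], and with it [E], inside [L]. *)
  - move=> KLM; apply: nzE; apply/is_zeroP => x Ex; apply: EL0 => //.
    by apply: addLT; [rewrite KLM|apply: ET].
  - move=> KLT; apply: nzK; apply/is_zeroP => x Kx; apply: KT0 => //.
    by rewrite -KLT; apply: addKL.
  - move/disjointP => TKL0; apply: nzL; apply/is_zeroP => x Lx.
    by apply: TKL0; [apply: LT|apply: sub_addmr].
suff sub K K' : complement K -> complement K' -> shadow S K = E ->
    shadow S K' = E -> addm K L = addm K' L -> {subset K <= K'}.
  move=> K K'; rewrite !inE => -[cK eqK] [cK' eqK'] eqKK'.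
  by apply: complement_eq => //; apply: sub.
move=> compK compK' eqK eqK' eqKL k Kk.
(* A complement with shadow [E] lies in S + E, not merely in S + T. *)
have decomp N x : complement N -> shadow S N = E -> x \in N ->
    exists s t, [/\ s \in S, t \in E & x = s + t].
  move=> compN <- Nx.
  have /addmP[s [t [Ss Tt eqx]]] : x \in addm S T by rewrite complement_addm.
  exists s, t; split=> //; apply/capmP; split=> //.
  apply/addmP; exists x, (- s); split=> //.
    by rewrite -sub0r submodB ?rpred0.
  by rewrite eqx addrC addKr.
have /addmP[k' [l [K'k' Ll eqk]]] : k \in addm K' L by rewrite -eqKL sub_addml.
have [s [t [Ss Et eqkst]]] := decomp _ _ compK eqK Kk.
have [s' [t' [Ss' Et' eqkst']]] := decomp _ _ compK' eqK' K'k'.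
(* Comparing components in S + T: s - s' lies in both [S] and [T], so l = t - t' lies in both [L]
   and [E] and vanishes. *)
have eql : l = (s - s') + (t - t').
  by rewrite addrACA -opprD -eqkst -eqkst' eqk addrC addKr.
have s0 : s - s' = 0.
  apply: ST0; first exact: submodB.
  have -> : s - s' = l - (t - t') by rewrite eql addrK.
  by apply: submodB; [apply: LT|apply/ET/submodB].
have l0 : l = 0 by apply: EL0 => //; rewrite eql s0 add0r submodB.
by rewrite eqk l0 addr0.
Qed.

End Complements.

(** * From fibres to endomorphisms and back, and the equivalence *)

Section Equivalence.
Variables (R : pzRingType) (M : lmodType R) (T : submodClosed M).
Implicit Types S E K : submodClosed M.

(** One member [K1] of the fibre supplies an isomorphism [f1] from [S] to [E]; composing with its
    inverse turns the graph maps of all members into endomorphisms of [S]. *)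
Lemma infinite_endo_of_fibre S E :
    maximal_submod T -> complement T S ->
    infinite_set [set K | (complement T K /\ K <> S) /\ shadow T S K = E] ->
  (exists f : {linear submod S -> submod E}, bijective f) /\
  infinite_set [set: endo (submod S)].
Proof.
move=> maxT compS infF.
have [K1 [[compK1 neqK1S] eqK1]] := infinite_setN0 infF.
have [f1 K1f1] : exists f : {linear submod S -> submod E}, bijective f.
  have [f Kf] := complement_map maxT compS compK1.
  have := complement_map_bij maxT compS compK1 neqK1S Kf.
  by move: f {Kf}; rewrite eqK1 => f; exists f.
split; first by exists f1.
have [g [f1K gK]] := linear_inverse K1f1.
(* The value 0 outside the fibre only makes the choice total. *)
have /choice[e eP] K : exists e : endo (submod S),
    (complement T K /\ K <> S) /\ shadow T S K = E ->
    forall s, val s + val (f1 (e s)) \in K.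
  have [[[compK _] eqK]|notF] := pselect
      ((complement T K /\ K <> S) /\ shadow T S K = E); last by exists 0.
  have [f Kf] : exists f : {linear submod S -> submod E},
      forall s, val s + val (f s) \in K.
    by have := complement_map maxT compS compK; rewrite eqK.
  exists (g \o f : {linear submod S -> submod S}) => _ s.
  by rewrite [f1 _]gK; apply: Kf.
move=> finEnd; apply: infF; apply: (finite_set_injto (f := e) _ _ finEnd) => //.
move=> K K'; rewrite !inE => FK FK' eqe.
have [[[compK _] eqK] [[compK' _] _]] := (FK, FK').
apply: (complement_eq maxT compK compK') => x.
(* [K] is exactly the graph of [f1] composed with [e K], so [e K] determines [K]. *)
case/(complement_graph maxT compS compK _ (eP K FK)) => [s|s ->].
  have ET : {subset E <= T} by rewrite -eqK => y /capmP[].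
  exact/ET/valP.
by rewrite eqe; apply: eP.
Qed.

(** Each is essential, so it meets the other; simplicity turns this into both inclusions. *)
Lemma essential_simple_unique E K :
  essential_simple_in T E -> essential_simple_in T K -> K = E.
Proof.
move=> [[ET essE] simE] [[KT essK] simK].
have [nzE _] := (simple_submodP E).1 simE.
have [nzK _] := (simple_submodP K).1 simK.
apply: submod_inj => x; apply/idP/idP.
  exact: simple_subset simK (essK E ET nzE) x.
exact: simple_subset simE (essE K KT nzK) x.
Qed.

Lemma infinite_graphs S E :
    simple_module (submod S) -> simple_module (submod E) -> {subset E <= T} ->
    is_zero [predI S & T] -> isomorphic (submod E) (submod S) ->
    infinite_set [set: endo (submod S)] ->
  infinite_set (vertices M).
Proof.
move=> simS simE ET /disjointP ST0 [h /linear_inverse[g [hK gK]]] infEnd finM.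
(* The graph of the map [g] after [e] from [S] to [E]. *)
pose A (e : endo (submod S)) x := exists s, x = val s + val (g (e s)).
have A_submod e : A e 0 /\ forall a x y, A e x -> A e y -> A e (a *: x + y).
  split=> [|a _ _ [s ->] [s' ->]]; first by exists 0; rewrite !linear0 addr0.
  by exists (a *: s + s'); rewrite !linearP /= addrACA -scalerDr.
(* The sum of [S] and [E] is direct, so a graph determines its map. *)
have A_eq s t s' t' : val s + val t = val s' + val t' -> s = s' :> submod S /\
    t = t' :> submod E.
  move=> eqst; have eqB : val s - val s' = val t' - val t.
    by apply/eqP; rewrite subr_eq addrAC (addrC (val t')) -eqst addrK.
  have s0 : val s - val s' = 0.
    apply: ST0; first by apply: submodB; apply: valP.
    by rewrite eqB; apply: submodB; apply/ET/valP.
  split; first exact/val_inj/subr0_eq.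
  by apply/val_inj/esym/subr0_eq; rewrite -eqB.
apply: infEnd; apply: (finite_set_injto (f := fun e => submod_of (A_submod e))
  _ _ finM).
  move=> e e' _ _ eqA; apply: endoP => s.
  have : val s + val (g (e s)) \in submod_of (A_submod e).
    by apply/submod_ofP; exists s.
  by rewrite eqA => /submod_ofP[s' /A_eq[<- /(can_inj gK)]].
move=> e _; split.
  have [[s /eqP s0] _] := simS; move=> /is_zeroP graph0; apply: s0.
  have : val s + val (g (e s)) = val (0 : submod S) + val (0 : submod E).
    by rewrite !linear0 addr0; apply/graph0/submod_ofP; exists s.
  by case/A_eq.
(* A graph is not all of [M]: an element t of [E] on it lies over s = 0, so t = 0. *)
have [[t /eqP t0] _] := simE; move=> graphM; apply: t0.
have /submod_ofP[s] : val t \in submod_of (A_submod e) by rewrite graphM.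
rewrite -[LHS]add0r -(linear0 (val : submod S -> M)) => /A_eq[<- ->].
by rewrite !linear0.
Qed.

End Equivalence.

Theorem corollary2p3 (R : pzRingType) (M : lmodType R) (T : submodClosed M)
    (maxT : maximal_submod T) :
  (infinite_set (vertices M) /\ finite_set (neighbours T)) <->
  (exists S S' : submodClosed M,
    [/\ simple_module (submod S) /\ direct_sum S T,
        (essential_simple_in T S' /\
           forall K : submodClosed M, essential_simple_in T K -> K = S') /\
          isomorphic (submod S') (submod S),
        division_ring (endo (submod S)) /\ infinite_set [set: endo (submod S)]
      & finite_set (vertices (quotmod S'))]).
Proof.
split.
  move=> [infM finT]; have infC := infinite_complements infM finT.
  have [S compS] := infinite_setN0 infC.
  (* [S] itself is removed because its shadow is 0, while the pigeonhole below needs nonzero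
     shadows. *)
  have infC' : infinite_set [set K | complement T K /\ K <> S].
    exact: infinite_setD infC (finite_set1 S).
  have [E [nzE ET] infF] : exists2 E : submodClosed M,
      ~ is_zero E /\ {subset E <= T} &
      infinite_set [set K | (complement T K /\ K <> S) /\ shadow T S K = E].
    apply: infinite_fibre infC'; last exact: finite_nonzero_submods.
    move=> K [compK neqKS]; split; first exact: shadow_neq0.
    by move=> x /capmP[].
  have [[f f_bij] infEnd] := infinite_endo_of_fibre maxT compS infF.
  have simS := complement_simple maxT compS.
  have essE : essential_simple_in T E.
    split; last exact: simple_image f_bij.
    apply: (essential_of_infinite_fibre maxT compS nzE ET) finT => finF.
    by apply: infF; apply: sub_finite_set finF => K [[compK _] eqK].
  exists S, E; split.
  - split=> //; split; first by case: compS.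
    by move=> x; apply/addmP; rewrite complement_addm.
  - split; first by split=> // K; apply: essential_simple_unique.
    by have [g [fK gK]] := linear_inverse f_bij; exists g; exists f.
  - by split=> //; apply: simple_division_ring.
  - exact/finite_vertices_quotmodP/(finite_oversubmods nzE ET).
move=> [S [E [[simS [ST0 _]] [[[[ET essE] simE] _] isoES] [_ infEnd] finE]]].
split; first exact: infinite_graphs simS simE ET ST0 isoES infEnd.
(* It remains to see that every neighbour [K] of [T] contains [E]. As [E] is simple, it suffices
   that [E] meets [K], and it does because [E] is essential in [T] and the intersection of [T] and
   [K] is nonzero. *)
apply: sub_finite_set ((finite_vertices_quotmodP E).1 finE) => K [_ [_ TK]].
apply: simple_subset => // /disjointP EK0.
have nzTK : ~ is_zero (capm T K) by move/is_zeroI.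
have TKT : {subset capm T K <= T} by move=> x /capmP[].
apply: essE nzTK _ => //; apply/disjointP => x Ex /capmP[_ Kx].
exact: EK0.
Qed.
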